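(* Let $n\ge 2$ be an integer. Then $\mathbb{D}_n^{\ast}=[0,1]$. More precisely, for any $c\in[0,1]$ there exist uncountably many $\underline{\xi}\in\mathbb{R}^n$ with $\Theta^{\ast}(\underline{\xi})=c$. Moreover, these uncountably many vectors $\underline{\xi}$ may be chosen to be Liouville vectors, i.e. satisfying $\liminf_{Q\to\infty} Q^N\psi^{\ast}_{\underline{\xi}}(Q)=0$ for all $N$.
   Context: For $\underline{\xi}=(\xi_1,\ldots,\xi_n)\in\mathbb{R}^n$ and $Q\ge 1$, define $$\psi^{\ast}_{\underline{\xi}}(Q)=\min |b_0+b_1\xi_1+\cdots+b_n\xi_n|,$$ where the minimum is taken over all integer vectors $\underline{b}=(b_0,b_1,\ldots,b_n)\in\mathbb{Z}^{n+1}\setminus\{\underline{0}\}$ with $\max_{1\le i\le n}|b_i|\le Q$ (there is no size restriction on $b_0$). The Dirichlet constant of $\underline{\xi}$ with respect to one linear form is $$\Theta^{\ast}(\underline{\xi})=\limsup_{Q\to\infty} Q^n\psi^{\ast}_{\underline{\xi}}(Q),$$ which lies in $[0,1]$ by a variant of Dirichlet's Theorem. The Dirichlet spectrum with respect to one linear form and the maximum norm is $$\mathbb{D}_n^{\ast}=\{\Theta^{\ast}(\underline{\xi}) : \underline{\xi}\in\mathbb{R}^n\}\subseteq[0,1].$$ *)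

(* Defs.v *)
From mathcomp Require Import all_boot all_order all_algebra.
From mathcomp Require Import all_classical all_reals.
From mathcomp Require Import ereal topology normedtype.

Set Implicit Arguments.
Unset Strict Implicit.
Unset Printing Implicit Defensive.

Import Order.TTheory GRing.Theory Num.Theory.
Import numFieldNormedType.Exports.

Local Open Scope classical_set_scope.
Local Open Scope ring_scope.

(* b_0 + b_1 xi_1 + ... + b_n xi_n; entry 0 of b is b_0 and entry
   [lift ord0 i] is the coefficient of the i-th coordinate of xi. *)
Definition linform (R : realType) (n : nat) (xi : 'rV[R]_n)
    (b : 'rV[int]_n.+1) : R :=
  (b ord0 ord0)%:~R + \sum_(i < n) (b ord0 (lift ord0 i))%:~R * xi ord0 i.

Definition admissible (R : realType) (n : nat) (Q : R) : set 'rV[int]_n.+1 :=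
  [set b : 'rV[int]_n.+1 |
    b != 0 /\ forall i : 'I_n, `|b ord0 (lift ord0 i)|%:~R <= Q].

(* The infimum is a minimum: see [psi_star_min]. *)
Definition psi_star (R : realType) (n : nat) (xi : 'rV[R]_n) (Q : R) : R :=
  inf [set `|linform xi b| | b in @admissible R n Q].

Lemma psi_star_min (R : realType) (n : nat) (xi : 'rV[R]_n) (Q : R) :
  1 <= Q ->
  exists2 b, @admissible R n Q b & psi_star xi Q = `|linform xi b| /\
    forall b', @admissible R n Q b' -> `|linform xi b| <= `|linform xi b'|.
Proof.
move=> Q1.
suff [b bQ bmin] : exists2 b, @admissible R n Q b &
    forall b', @admissible R n Q b' -> `|linform xi b| <= `|linform xi b'|.
  exists b => //; split => //.
  apply/le_anti/andP; split.
    by apply: ge_inf; [exists 0 => _ [? _ <-] | exists b].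
  apply: lb_le_inf; first by exists `|linform xi b|, b.
  by move=> _ [b' b'Q <-]; exact: bmin.
have Q0 : 0 <= Q by apply: le_trans Q1.
pose B : R := 1 + \sum_(i < n) Q * `|xi ord0 i| + Q.
have B0 : 0 <= B by rewrite !addr_ge0 // sumr_ge0 // => i _; rewrite mulr_ge0.
pose M := Num.bound B.
have BM : B < M%:R by apply: archi_boundP.
pose v (f : {ffun 'I_n.+1 -> 'I_(2 * M).+1}) : 'rV[int]_n.+1 :=
  \row_i ((f i)%:Z - M%:Z).
have vP (b : 'rV[int]_n.+1) : (forall i, `|b ord0 i|%:~R <= B) -> {f | v f = b}.
  move=> bB.
  have bM i : `|b ord0 i| <= M%:Z.
    by rewrite -(ler_int R); apply: le_trans (bB i) (ltW BM).
  exists [ffun i => inord `|(b ord0 i + M%:Z)%R|%N].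
  apply/rowP => i; rewrite !mxE ffunE.
  have := bM i; rewrite ler_norml => /andP[b1 b2].
  have b3 : 0 <= b ord0 i + M%:Z by rewrite -lerBlDr sub0r.
  rewrite inordK; first by rewrite gez0_abs // addrK.
  rewrite ltnS -lez_nat gez0_abs // mul2n -addnn PoszD.
  by rewrite lerD2r.
pose e : 'rV[int]_n.+1 := \row_i (i == ord0)%:Z.
have eQ : @admissible R n Q e.
  split; first apply/eqP => e0.
    by have := congr1 (fun u : 'rV_n.+1 => u ord0 ord0) e0; rewrite !mxE eqxx.
  by move=> i; rewrite mxE eq_sym (negbTE (neq_lift _ _)) normr0.
have eL : `|linform xi e| = 1.
  rewrite /linform big1; first by rewrite mxE eqxx addr0 normr1.
  by move=> i _; rewrite mxE eq_sym (negbTE (neq_lift _ _)) mul0r.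
have small b : @admissible R n Q b -> `|linform xi b| <= 1 ->
    forall i, `|b ord0 i|%:~R <= B.
  move=> [_ bQ] b1 i; case: (unliftP ord0 i) => [j|] ->.
    apply: le_trans (bQ j) _; rewrite lerDr addr_ge0 //.
    by apply: sumr_ge0 => k _; rewrite mulr_ge0.
  have -> : `|b ord0 ord0|%:~R = `|linform xi b -
      \sum_(i < n) (b ord0 (lift ord0 i))%:~R * xi ord0 i| :> R.
    by rewrite /linform addrK intr_norm.
  apply: le_trans (ler_normB _ _) _; rewrite /B -addrA lerD // ler_wpDr //.
  apply: le_trans (ler_norm_sum _ _ _) _; apply: ler_sum => k _.
  by rewrite normrM ler_wpM2r // -intr_norm bQ.
have [f0 f0e] : {f | v f = e}.
  by apply/vP/small => //; rewrite eL.
have Pf0 : `[< @admissible R n Q (v f0) >] by rewrite f0e; apply/asboolP.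
case: (@Order.TotalTheory.arg_minP _ _ _ f0
  (fun f => `[< @admissible R n Q (v f) >]) (fun f => `|linform xi (v f)|) Pf0).
move=> f /asboolP fQ fmin; exists (v f) => // b bQ.
have [b1|b1] := leP `|linform xi b| 1.
  have [g gb] := vP _ (small _ bQ b1).
  by rewrite -gb; apply: fmin; rewrite gb; apply/asboolP.
by apply: le_trans (fmin _ Pf0) _; rewrite f0e eL ltW.
Qed.

(* The upper limit over real Q -> +oo is taken in [\bar R], so that no default
   value of a real-valued limsup can enter the definition of the spectrum. *)
Definition Theta_star (R : realType) (n : nat) (xi : 'rV[R]_n) : \bar R :=
  limf_esup (fun Q : R => (Q ^+ n * psi_star xi Q)%:E) (pinfty_nbhs R).

Definition Dirichlet_spectrum (R : realType) (n : nat) : set (\bar R) :=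
  range (@Theta_star R n).

Definition Liouville_vector (R : realType) (n : nat) (xi : 'rV[R]_n) : Prop :=
  forall N : nat,
    limf_einf (fun Q : R => (Q ^+ N * psi_star xi Q)%:E) (pinfty_nbhs R)
      = 0%E.

(* Main.v *)
Require Import Defs.
From mathcomp Require Import all_boot all_order all_algebra.
From mathcomp Require Import all_classical all_reals.
From mathcomp Require Import ereal topology normedtype.
From mathcomp Require Import ring lra zify.

Local Open Scope classical_set_scope.
Local Open Scope ring_scope.

Import Order.TTheory GRing.Theory Num.Theory.
Import numFieldNormedType.Exports.

Set Implicit Arguments.
Unset Strict Implicit.
Unset Printing Implicit Defensive.

(** The inclusion of the spectrum in [0, 1] is Dirichlet's pigeonhole argument
    ([dirichlet_linform]).  For the converse, write the vectors as
    (xi_0, ..., xi_n) with n >= 1, and let N = n + 1 be the dimension.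

    The vector xi is the common point of a nested sequence of cubes.  A stage
    records a cube whose centre has first coordinate p/A in lowest terms, so
    that the form A xi_0 - p is very small.  To pass to the next stage, take a
    huge prime B and move the other coordinates to fractions with denominators
    B^n, ..., B^2, B and numerators prime to B.  At the resulting rational
    point rho, an integer form whose non-constant coefficients are smaller than
    B in absolute value behaves like a number written in base B: if it vanishes
    at rho, its digits vanish one after the other ([digits_eq0]), hence it is a multiple of
    A xi_0 - p; if it does not vanish, its value is at least 1/(A B^n).  Now
    move the first coordinate away from p/A, to a rational number at distance
    about c/(A B^N).  The form A xi_0 - p becomes about c/B^N, while the forms
    that do not vanish at rho stay above about (1 - c)/(A B^n), which is larger
    because B is much larger than A.  So A xi_0 - p realises the minimum for
    every Q in [A, B), and Q^N psi(Q) increases to about c as Q tends to B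
    ([stage_bounds]).  For c = 1 the targets approach 1 from below.

    From Q = B on, the form B xi_n - v is available.  It vanishes at the new
    centre, so shrinking the new cube makes it as small as desired over any
    prescribed range of Q, in particular up to a point where the form of the
    next stage takes over.  This keeps Q^N psi(Q) below c + o(1) throughout,
    and makes Q^k psi(Q) small at Q = B in the k-th stage, so that xi is a
    Liouville vector ([next_stage]).

    Each stage can also avoid one given vector: there are two possible choices
    for the new first coordinate.  Hence no enumeration contains all the vectors
    with these properties ([exists_Liouville_avoiding]). *)

(** * Elementary bounds for the minimum *)

Lemma psi_star_ge0 (R : realType) (n : nat) (xi : 'rV[R]_n) (Q : R) :
  1 <= Q -> 0 <= psi_star xi Q.
Proof. by move=> /(psi_star_min xi)[b _ [-> _]]. Qed.

Lemma psi_star_le (R : realType) (n : nat) (xi : 'rV[R]_n) (Q : R) b :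
  @admissible R n Q b -> psi_star xi Q <= `|linform xi b|.
Proof. by move=> bQ; apply: ge_inf; [exists 0 => _ [? _ <-] | exists b]. Qed.

Lemma psi_star_ge (R : realType) (n : nat) (xi : 'rV[R]_n) (Q z : R) :
  1 <= Q -> (forall b, @admissible R n Q b -> z <= `|linform xi b|) ->
  z <= psi_star xi Q.
Proof. by move=> /(psi_star_min xi)[b bQ [-> _]]; exact. Qed.

Lemma psi_star_le_coord (R : realType) (n : nat) (xi : 'rV[R]_n) (i : 'I_n)
    (a : nat) (p : int) (Q : R) :
  (0 < a)%N -> a%:R <= Q ->
  psi_star xi Q <= `|a%:R * xi ord0 i - p%:~R|.
Proof.
move=> a0 aQ.
pose b : 'rV[int]_n.+1 := \row_j
  (if j == ord0 then - p else if j == lift ord0 i then a%:Z else 0).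
have b0 : b ord0 ord0 = - p by rewrite mxE eqxx.
have bl j : b ord0 (lift ord0 j) = if j == i then a%:Z else 0.
  by rewrite mxE (inj_eq lift_inj).
have -> : a%:R * xi ord0 i - p%:~R = linform xi b.
  rewrite /linform b0 mulrNz addrC (bigD1 i)//= bl eqxx big1 ?addr0// => j ji.
  by rewrite bl (negbTE ji) mul0r.
apply: psi_star_le; split.
  apply/eqP => /(congr1 (fun u : 'rV_n.+1 => u ord0 (lift ord0 i))).
  by rewrite bl eqxx mxE; lia.
move=> j; rewrite bl; case: eqP => _; first by rewrite ger0_norm.
by rewrite normr0 (le_trans _ aQ).
Qed.

(** * Forms near a point with base-B coordinates *)

(** Uniqueness of an expansion in base [B] whose only digit divisible by [B]
    is 0: modulo [B] the equation kills the lowest digit, and dividing by [B]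
    removes it. *)
Lemma digits_eq0 (B : int) (n : nat) (d : 'I_n -> int) (e : int) :
  B != 0 -> (forall j, (B %| d j)%Z -> d j = 0) ->
  \sum_(j < n) d j * B ^+ j + e * B ^+ n = 0 -> (forall j, d j = 0) /\ e = 0.
Proof.
move=> B0; elim: n d => [|n IHn] d dB.
  by rewrite big_ord0 add0r expr0 mulr1 => ->; split=> // -[].
have -> : \sum_(j < n.+1) d j * B ^+ j + e * B ^+ n.+1 = d ord0 +
    (\sum_(j < n) d (lift ord0 j) * B ^+ j + e * B ^+ n) * B.
  rewrite big_ord_recl expr0 mulr1 -addrA mulrDl mulr_suml exprSr mulrA.
  by congr (_ + (_ + _)); apply: eq_bigr => j _; rewrite /= /bump exprSr mulrA.
move=> s0; have d0 : d ord0 = 0.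
  by apply: dB; rewrite -[d ord0]opprK rpredN (addr0_eq s0) dvdz_mull.
move: s0; rewrite d0 add0r => /eqP; rewrite mulf_eq0 (negbTE B0) orbF => /eqP s0.
have [|dj ->] := IHn _ _ s0; first by move=> j; exact: dB.
by split=> // j; case: (unliftP ord0 j) => [i|] ->.
Qed.

Lemma linform_lipschitz (R : realType) (n : nat) (xi xi' : 'rV[R]_n) (Q : R) b :
  @admissible R n Q b ->
  `|linform xi b - linform xi' b| <= Q * \sum_i `|xi ord0 i - xi' ord0 i|.
Proof.
move=> [_ bQ]; rewrite /linform opprD addrACA subrr add0r -sumrB mulr_sumr.
apply: le_trans (ler_norm_sum _ _ _) _; apply: ler_sum => i _.
by rewrite -mulrBr normrM ler_wpM2r// -intr_norm bQ.
Qed.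

(** After multiplication by [A * B ^ n], the coordinate of index
    [lift ord0 j] has weight [B ^ j].  The descending exponents make the integer form a
    base-[B] expansion, and give the last coordinate the denominator [B],
    which is the height of the form that takes over when Q reaches [B]. *)
Definition radix_point (R : realType) (n : nat) (p : int) (A B : nat)
    (v : 'I_n -> int) : 'rV[R]_n.+1 :=
  \row_i if unlift ord0 i is Some j then (v j)%:~R / B%:R ^+ (n - j)
         else p%:~R / A%:R.

Lemma radix_point0 (R : realType) n p A B (v : 'I_n -> int) :
  radix_point R p A B v ord0 ord0 = p%:~R / A%:R.
Proof. by rewrite mxE unlift_none. Qed.

Lemma radix_pointS (R : realType) n p A B (v : 'I_n -> int) j :
  radix_point R p A B v ord0 (lift ord0 j) = (v j)%:~R / B%:R ^+ (n - j).
Proof. by rewrite mxE liftK. Qed.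

Lemma linform_radix_point (R : realType) n p A B (v : 'I_n -> int) b :
  (0 < A)%N -> (0 < B)%N ->
  linform (radix_point R p A B v) b * (A%:R * B%:R ^+ n) =
  (\sum_(j < n) A%:Z * v j * b ord0 (lift ord0 (lift ord0 j)) * B%:Z ^+ j
   + (b ord0 (lift ord0 ord0) * p + b ord0 ord0 * A%:Z) * B%:Z ^+ n)%:~R.
Proof.
move=> A0 B0; have A0' : A%:R != 0 :> R by rewrite pnatr_eq0 -lt0n.
have B0' : B%:R != 0 :> R by rewrite pnatr_eq0 -lt0n.
rewrite /linform big_ord_recl radix_point0 !mulrDl mulr_suml !rmorphD/= addrA.
rewrite addrC; congr (_ + _); last first.
  rewrite !rmorphM/= rmorphXn/= [X in _ = X]addrC; congr (_ + _); first by ring.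
  by field.
rewrite rmorph_sum/=; apply: eq_bigr => j _.
rewrite radix_pointS !rmorphM/= rmorphXn/=.
have -> : B%:R ^+ n = B%:R ^+ (n - j) * B%:R ^+ j :> R.
  by rewrite -exprD subnK// ltnW.
have : B%:R ^+ (n - j) != 0 :> R by rewrite expf_neq0.
by set c := B%:R ^+ (n - j) => c0; field.
Qed.

(** The digits of the form at the rational point are [A * v j * b_j], and [B]
    divides one of them only if it divides [b_j], that is, only if [b_j = 0]
    because [`|b_j| < B].  So a form vanishing at the point is a nonzero
    multiple of the form of height [A], and it stays so at [xi].  Any other form
    has numerator at least 1 at the point, and moves little between the point
    and [xi]. *)
Lemma linform_near_radix_point (R : realType) n (xi : 'rV[R]_n.+1) p A B
    (v : 'I_n -> int) (d eps Q : R) b :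
  (0 < A)%N -> coprime `|p| A -> prime B -> (A < B)%N ->
  (forall j, ~~ (B%:Z %| v j)%Z) ->
  `|xi ord0 ord0 - p%:~R / A%:R| <= d ->
  (forall j, `|xi ord0 (lift ord0 j) -
      radix_point R p A B v ord0 (lift ord0 j)| <= eps) ->
  Q < B%:R -> @admissible R n.+1 Q b ->
  `|A%:R * xi ord0 ord0 - p%:~R| <= `|linform xi b| \/
  (A%:R * B%:R ^+ n)^-1 - B%:R * (d + n%:R * eps) <= `|linform xi b|.
Proof.
move=> A0 pA Bp AB vB xi0 xiS QB bQ.
have B0 := prime_gt0 Bp.
have AR0 : 0 < A%:R :> R by rewrite ltr0n.
have BR0 : 0 < B%:R :> R by rewrite ltr0n.
have := linform_radix_point R p v b A0 B0.
set N := (X in _ = X%:~R) => LN.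
have [N0|N0] := eqVneq N 0.
  left; have AcB : coprimez B%:Z A%:Z.
    rewrite coprimezE !absz_nat prime_coprime//.
    by apply/negP => /dvdn_leq; lia.
  have bB i : (B%:Z %| b ord0 (lift ord0 i))%Z -> b ord0 (lift ord0 i) = 0.
    move=> Bb; apply/eqP; apply: contraTT Bb => b0.
    have := le_lt_trans (bQ.2 i) QB.
    rewrite -[B%:R]/(B%:Z%:~R) ltr_int => bltB.
    apply/negP => /dvdzP[q bq]; move: bltB b0; rewrite bq normrM [`|B%:Z|]ger0_norm//.
    move=> h; rewrite mulf_eq0 negb_or => /andP[q0 _]; nia.
  have [| |dj e0] := @digits_eq0 B%:Z n
      (fun j => A%:Z * v j * b ord0 (lift ord0 (lift ord0 j))) _ _ _ N0.
  - by lia.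
  - move=> j; rewrite -mulrA Gauss_dvdzr// Gauss_dvdzr; last first.
      by rewrite coprimezE absz_nat prime_coprime//; exact: vB.
    by move=> /bB ->; rewrite !mulr0.
  have bS j : b ord0 (lift ord0 (lift ord0 j)) = 0.
    apply: bB; move: (dj j) => /eqP; rewrite !mulf_eq0 -orbA => /or3P[|/eqP vj|/eqP ->].
    - by lia.
    - by have := vB j; rewrite vj dvdz0.
    - by rewrite dvdz0.
  have /dvdzP[t bt] : (A%:Z %| b ord0 (lift ord0 ord0))%Z.
    rewrite -(@Gauss_dvdzl _ _ p); last by rewrite coprimezE absz_nat coprime_sym.
    by rewrite -[X in (_ %| X)%Z]opprK rpredN (addr0_eq e0) dvdz_mull.
  have b0 : b ord0 ord0 = - (t * p).
    move: e0; rewrite bt; nia.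
  have t0 : t != 0.
    apply: contraNneq bQ.1 => t0; apply/eqP/rowP => i; rewrite mxE.
    case: (unliftP ord0 i) => [i' ->|->]; last by rewrite b0 t0 mul0r oppr0.
    by case: (unliftP ord0 i') => [j ->|->]; rewrite ?bS// bt t0 mul0r.
  have -> : linform xi b = t%:~R * (A%:R * xi ord0 ord0 - p%:~R).
    rewrite /linform big_ord_recl big1 => [|j _]; last by rewrite bS mul0r.
    by rewrite b0 bt rmorphN !rmorphM/=; ring.
  rewrite normrM ler_peMl// -intr_norm -[1]/(1%:Z%:~R) ler_int; lia.
right; set L0 := linform (radix_point R p A B v) b in LN.
have L0ge : (A%:R * B%:R ^+ n)^-1 <= `|L0|.
  rewrite -[X in X <= _]mul1r ler_pdivrMr; last by rewrite mulr_gt0// exprn_gt0.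
  have := congr1 Num.norm LN; rewrite normrM (@gtr0_norm _ (_ * _ ^+ _)).
    by move=> ->; rewrite -intr_norm -[1]/(1%:Z%:~R) ler_int; lia.
  by rewrite mulr_gt0// exprn_gt0.
apply: le_trans (lerB L0ge (lexx _)) _; rewrite lerBlDr.
have := @linform_lipschitz _ _ xi (radix_point R p A B v) _ _ bQ; rewrite -/L0.
move=> Lip; have Q0 : 0 <= Q by apply: le_trans (bQ.2 ord0); rewrite ler0z.
have : `|linform xi b - L0| <= B%:R * (d + n%:R * eps).
  apply: le_trans Lip _; apply: ler_pM => //; first by apply: sumr_ge0.
    exact: ltW.
  rewrite big_ord_recl radix_point0 lerD//.
  apply: le_trans (ler_sum _ (fun j _ => xiS j)) _.
  by rewrite sumr_const card_ord mulr_natl.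
have := ler_distD (linform xi b) L0 0; rewrite !subr0 distrC; lra.
Qed.

(** * The upper bound 1 *)

(** Pigeonhole: the [(q + 1) ^ n] values modulo 1 of the forms with coefficients in
    [0, ..., q] fall into [(q + 1) ^ n - 1] boxes. *)
Lemma dirichlet_linform (R : realType) (n : nat) (xi : 'rV[R]_n) (Q : R) :
  (0 < n)%N -> 1 <= Q -> (Q ^+ n - 1) * psi_star xi Q <= 1.
Proof.
move=> n0 Q1; have Q0 : 0 <= Q by apply: le_trans Q1.
pose q := Num.truncn Q.
have [qQ Qq] : q%:R <= Q /\ Q < q.+1%:R by apply/andP/truncn_itv.
have q0 : (0 < q)%N by rewrite -ltnS -(ltr_nat R); apply: le_lt_trans Qq.
have q2 : (1 < q.+1 ^ n)%N by rewrite -(exp1n n) ltn_exp2r.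
(* [M + 1] boxes, with one point more than boxes. *)
have [M MP] : exists M, (q.+1 ^ n = M.+2)%N by exists (q.+1 ^ n).-2; lia.
pose s (f : {ffun 'I_n -> 'I_q.+1}) : R := \sum_i (f i)%:R * xi ord0 i.
pose fr f : R := s f - (Num.floor (s f))%:~R.
have fr01 f : 0 <= fr f < 1.
  by have := floor_itv (s f); rewrite rmorphD/= /fr; lra.
pose g f : 'I_M.+1 := inord (Num.truncn (M.+1%:R * fr f)).
have gP f : (g f)%:R <= M.+1%:R * fr f < (g f)%:R + 1.
  have /andP[f0 f1] := fr01 f.
  have Mf0 : 0 <= M.+1%:R * fr f by rewrite mulr_ge0.
  have tr := truncn_itv Mf0; rewrite natr1 /g inordK//.
  rewrite -(ltr_nat R); have /andP[+ _] := tr.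
  by move=> /le_lt_trans; apply; rewrite -[ltRHS]mulr1 ltr_pM2l// ltr0n.
have /injectivePn[f [f' ff' gff']] : ~~ injectiveb g.
  apply/negP => /injectiveP/leq_card.
  by rewrite card_ffun !card_ord MP ltnn.
have frff' : `|fr f - fr f'| <= M.+1%:R^-1.
  have := gP f; have := gP f'; rewrite gff' => /andP[? ?] /andP[? ?].
  rewrite -[leRHS]mul1r ler_pdivlMr ?ltr0n// mulrC.
  rewrite -[X in X * _]ger0_norm// -normrM mulrBr ler_norml; apply/andP; split; lra.
pose b : 'rV[int]_n.+1 := \row_i (if unlift ord0 i is Some j then
  (f j)%:Z - (f' j)%:Z else Num.floor (s f') - Num.floor (s f)).
have b0 : b ord0 ord0 = Num.floor (s f') - Num.floor (s f).
  by rewrite mxE unlift_none.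
have bS j : b ord0 (lift ord0 j) = (f j)%:Z - (f' j)%:Z by rewrite mxE liftK.
have bQ : @admissible R n Q b.
  split; last first.
    move=> j; apply: le_trans qQ; rewrite -[q%:R]/(q%:Z%:~R) ler_int bS.
    by have := ltn_ord (f j); have := ltn_ord (f' j); lia.
  apply: contraNneq ff' => be0; apply/eqP/ffunP => j; apply/val_inj => /=.
  by have := bS j; rewrite be0 mxE => /esym/eqP; rewrite subr_eq0 => /eqP[].
have Lb : linform xi b = fr f - fr f'.
  rewrite /linform b0 rmorphB/= /fr /s.
  under eq_bigr do rewrite bS rmorphB/= mulrBl.
  by rewrite sumrB; ring.
have QM : Q ^+ n - 1 <= M.+1%:R.
  have -> : M.+1%:R = q.+1%:R ^+ n - 1 :> R.
    by rewrite -natrX MP [in RHS]mulrSr addrK.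
  by rewrite lerD2r lerXn2r ?nnegrE// ltW.
apply: (@le_trans _ _ (M.+1%:R * psi_star xi Q)).
  by rewrite ler_wpM2r// psi_star_ge0.
rewrite mulrC -ler_pdivlMr ?ltr0n// mul1r.
by apply: le_trans (psi_star_le xi bQ) _; rewrite Lb.
Qed.

Lemma le_limf_esup_pinfty (R : realType) (f : R -> R) (c : R) :
  (forall e M : R, 0 < e -> exists2 Q, M < Q & c - e <= f Q) ->
  (c%:E <= limf_esup (fun Q => (f Q)%:E) (pinfty_nbhs R))%E.
Proof.
move=> h; apply: le_ereal_inf_tmp => _ [V [M [_ MV]] <-].
apply/lee_subgt0Pr => e e0.
have [Q /MV QV cQ] := h e M e0.
apply: (@le_trans _ _ (f Q)%:E); first by rewrite -EFinB lee_fin.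
by apply: ereal_sup_ubound; exists Q.
Qed.

Lemma limf_esup_pinfty_le (R : realType) (f : R -> R) (c : R) :
  (forall e : R, 0 < e -> exists M, forall Q, M < Q -> f Q <= c + e) ->
  (limf_esup (fun Q => (f Q)%:E) (pinfty_nbhs R) <= c%:E)%E.
Proof.
move=> h; apply/lee_addgt0Pr => e e0; have [M hM] := h e e0.
apply: (@le_trans _ _ (ereal_sup ((fun Q => (f Q)%:E) @` [set Q | M < Q]))).
  apply: ereal_inf_lbound; exists [set Q | M < Q] => //.
  by exists M; split=> //; exact: num_real.
by apply: ge_ereal_sup => _ [Q MQ <-]; rewrite -EFinD lee_fin hM.
Qed.

Lemma Theta_star_ge0 (R : realType) (n : nat) (xi : 'rV[R]_n) :
  (0 <= Theta_star xi)%E.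
Proof.
apply: le_limf_esup_pinfty => e M e0; exists (`|M| + 1).
  by have := ler_norm M; lra.
apply: (@le_trans _ _ 0); first by rewrite sub0r oppr_le0 ltW.
by rewrite mulr_ge0 ?exprn_ge0 ?addr_ge0// psi_star_ge0// lerDr.
Qed.

Lemma Theta_star_le1 (R : realType) (n : nat) (xi : 'rV[R]_n) :
  (0 < n)%N -> (Theta_star xi <= 1)%E.
Proof.
move=> n0; apply: limf_esup_pinfty_le => e e0; exists (2 + e^-1) => Q QM.
have ei0 : 0 < e^-1 by rewrite invr_gt0.
have Q1 : 1 <= Q by lra.
have QQ : Q <= Q ^+ n by rewrite ler_eXnr.
have := dirichlet_linform xi n0 Q1; have := psi_star_ge0 xi Q1.
set P := psi_star xi Q => P0 h.
suff : P <= e by lra.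
have : (1 + e^-1) * P <= 1.
  by apply: le_trans h; rewrite ler_wpM2r//; lra.
rewrite mulrDl mul1r => h'.
have : e^-1 * P <= 1 by lra.
by rewrite mulrC ler_pdivrMr// mul1r.
Qed.

(** * One stage of the construction *)

(** Of two consecutive integers, at most one is divisible by [B]. *)
Lemma prime_power_approx (R : realType) (B i : nat) (x : R) :
  prime B -> (0 < i)%N ->
  exists2 v : int, ~~ (B%:Z %| v)%Z & `|v%:~R / B%:R ^+ i - x| <= B%:R^-1.
Proof.
move=> Bp i0; have B1 := prime_gt1 Bp.
have BR1 : 1 <= B%:R :> R by rewrite ler1n prime_gt0.
have BR0 : 0 < B%:R :> R by apply: lt_le_trans BR1.
have Bi0 : 0 < B%:R ^+ i :> R by rewrite exprn_gt0.
set f := Num.floor (x * B%:R ^+ i).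
have close (v : int) : `|v%:~R - x * B%:R ^+ i| <= 1 ->
    `|v%:~R / B%:R ^+ i - x| <= B%:R^-1.
  move=> vx; have -> : v%:~R / B%:R ^+ i - x = (v%:~R - x * B%:R ^+ i) / B%:R ^+ i.
    by field; rewrite gt_eqF.
  rewrite normrM normfV (gtr0_norm Bi0) ler_pdivrMr//.
  apply: le_trans vx _; rewrite mulrC ler_pdivlMr// mul1r.
  by rewrite ler_eXnr.
have /andP[fx xf] := floor_itv (x * B%:R ^+ i); rewrite -/f rmorphD/= in fx xf.
have [Bf|Bf] := boolP (B%:Z %| f)%Z; last first.
  by exists f => //; apply: close; rewrite ler_norml; apply/andP; split; lra.
exists (f + 1); last first.
  apply: close; rewrite rmorphD/= ler_norml; apply/andP; split; lra.
apply/negP => Bf1; have := rpredB Bf1 Bf.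
by rewrite addrAC subrr add0r dvdz1; lia.
Qed.

(** Two rationals are available in the interval, and [y] equals at most one of
    them.  This freedom is what makes the constructed set uncountable. *)
Lemma rat_itv_avoid (R : realType) (s t y : R) : s < t ->
  exists p A, [/\ (0 < A)%N, coprime `|p| A, s < p%:~R / A%:R :> R,
    p%:~R / A%:R < t & p%:~R / A%:R != y].
Proof.
move=> st.
have [q [/andP[sq qt] qy]] : exists q : rat, s < ratr q < t /\ ratr q != y.
  have [q1] := rat_in_itvoo st; rewrite in_itv/= => /andP[sq1 q1t].
  have [q2] := rat_in_itvoo q1t; rewrite in_itv/= => /andP[q12 q2t].
  have [q1y|] := eqVneq (ratr q1) y; last by exists q1; rewrite sq1.
  exists q2; rewrite (lt_trans sq1) ?q2t//; split=> //.
  by rewrite -q1y gt_eqF.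
have dq := denq_gt0 q.
have qE : ratr q = (numq q)%:~R / (`|denq q|%N)%:R :> R.
  by rewrite /ratr pmulrn gtz0_abs.
exists (numq q), `|denq q|%N; rewrite -qE; split=> //; first by lia.
exact: coprime_num_den.
Qed.

Lemma pos_lower_bound (R : realType) (s : seq R) : all (fun z => 0 < z) s ->
  exists2 r, 0 < r & all (fun z => r <= z) s.
Proof.
elim: s => [|z s IHs] /=; first by exists 1.
move=> /andP[z0 /IHs[r r0 rs]]; exists (Num.min z r); first by rewrite lt_min z0.
rewrite ge_min lexx/=; apply: sub_all rs => w rw.
by rewrite ge_min rw orbT.
Qed.

Lemma bernoulli_sub (R : realType) (a : R) (n : nat) : 0 <= a <= 1 ->
  1 - n%:R * a <= (1 - a) ^+ n.
Proof.
move=> /andP[a0 a1]; elim: n => [|n IHn]; first by rewrite expr0 mul0r subr0.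
apply: (@le_trans _ _ ((1 - a) * (1 - n%:R * a))); last first.
  by rewrite exprS ler_wpM2l// subr_ge0.
have : 0 <= n%:R * (a * a) by rewrite !mulr_ge0.
by rewrite -natr1; lra.
Qed.

(** Before [B] the form of height [A] is minimal, since by the hypothesis on
    [eps] its value is below that of every form not vanishing at the rational
    point; from [B] on, the last coordinate provides a form of value at most
    [B * eps]. *)
Lemma stage_bounds (R : realType) (n : nat) (xi : 'rV[R]_n.+1) p A B
    (v : 'I_n -> int) (l h eps : R) :
  (0 < n)%N -> (0 < A)%N -> coprime `|p| A -> prime B -> (A < B)%N ->
  (forall j, ~~ (B%:Z %| v j)%Z) -> 0 <= l -> 0 <= h ->
  l / (A%:R * B%:R ^+ n.+1) <= xi ord0 ord0 - p%:~R / A%:R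
    <= h / (A%:R * B%:R ^+ n.+1) ->
  (forall j, `|xi ord0 (lift ord0 j) -
      radix_point R p A B v ord0 (lift ord0 j)| <= eps) ->
  l / B%:R ^+ n.+1 + B%:R * (n%:R * eps) <= (1 - h) / (A%:R * B%:R ^+ n) ->
  [/\ forall Q, A%:R <= Q < B%:R -> Q ^+ n.+1 * psi_star xi Q <= h,
      forall Q, 1 <= Q < B%:R -> l / B%:R ^+ n.+1 <= psi_star xi Q &
      forall Q, B%:R <= Q -> psi_star xi Q <= B%:R * eps].
Proof.
move=> n0 A0 pA Bp AB vB l0 h0 /andP[xil xih] xiS gap.
have AR0 : 0 < A%:R :> R by rewrite ltr0n.
have BR0 : 0 < B%:R :> R by rewrite ltr0n prime_gt0.
have BN0 : 0 < B%:R ^+ n.+1 :> R by rewrite exprn_gt0.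
have Bn0 : 0 < B%:R ^+ n :> R by rewrite exprn_gt0.
have W0 : 0 < A%:R * B%:R ^+ n.+1 :> R by rewrite mulr_gt0.
have AE : A%:R * xi ord0 ord0 - p%:~R = A%:R * (xi ord0 ord0 - p%:~R / A%:R).
  by field; rewrite gt_eqF.
have dE (z : R) : z / B%:R ^+ n.+1 = A%:R * (z / (A%:R * B%:R ^+ n.+1)).
  by field; rewrite !gt_eqF.
have xi0 : 0 <= xi ord0 ord0 - p%:~R / A%:R.
  by apply: le_trans xil; rewrite divr_ge0// ltW.
have nA : `|A%:R * xi ord0 ord0 - p%:~R| = A%:R * (xi ord0 ord0 - p%:~R / A%:R).
  by rewrite AE ger0_norm// mulr_ge0// ltW.
split=> Q.
- move=> /andP[AQ QB]; have Q0 : 0 <= Q by apply: le_trans AQ.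
  have psiA := psi_star_le_coord xi ord0 p A0 AQ.
  have Q1 : 1 <= Q by apply: le_trans AQ; rewrite ler1n.
  apply: (@le_trans _ _ (B%:R ^+ n.+1 * (h / B%:R ^+ n.+1))); last first.
    by rewrite mulrC divfK// gt_eqF.
  apply: ler_pM; rewrite ?exprn_ge0 ?psi_star_ge0//.
    by rewrite lerXn2r ?nnegrE // ltW.
  by apply: le_trans psiA _; rewrite nA dE ler_wpM2l// ltW.
- move=> /andP[Q1 QB]; apply: psi_star_ge => // b bQ.
  have xih' : `|xi ord0 ord0 - p%:~R / A%:R| <= h / (A%:R * B%:R ^+ n.+1).
    by rewrite ger0_norm.
  have [] := linform_near_radix_point A0 pA Bp AB vB xih' xiS QB bQ.
    by apply: le_trans; rewrite nA dE ler_wpM2l// ltW.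
  apply: le_trans.
  have -> : (A%:R * B%:R ^+ n)^-1 -
      B%:R * (h / (A%:R * B%:R ^+ n.+1) + n%:R * eps) =
      (1 - h) / (A%:R * B%:R ^+ n) - B%:R * (n%:R * eps).
    by rewrite exprS; field; rewrite !gt_eqF.
  by rewrite lerBrDr.
- move=> BQ; case: n n0 xi v vB xil xih xiS gap W0 BN0 Bn0 AE dE xi0 nA => // m _.
  move=> xi v vB _ _ xiS _ _ _ _ _ _ _ _.
  have := psi_star_le_coord xi (lift ord0 ord_max) (v ord_max) (prime_gt0 Bp) BQ.
  move=> /le_trans; apply; have := xiS ord_max; rewrite radix_pointS /= subSnn expr1.
  move=> h1; have -> : B%:R * xi ord0 (lift ord0 ord_max) - (v ord_max)%:~R =
      B%:R * (xi ord0 (lift ord0 ord_max) - (v ord_max)%:~R / B%:R).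
    by field; rewrite gt_eqF.
  by rewrite normrM gtr0_norm// ler_wpM2l// ltW.
Qed.

Record stage (R : realType) (n : nat) := Stage {
  centre : 'rV[R]_n.+1; halfwidth : R; reach : R; den : nat; num : int }.

(** Only the first coordinate of the centre has to be rational: its form, of
    height [den s], serves from [reach s] until the next prime. *)
Definition stage_ok (R : realType) (n : nat) (s : stage R n) : Prop :=
  [/\ 0 < halfwidth s, (0 < den s)%N, coprime `|num s| (den s),
      centre s ord0 ord0 = (num s)%:~R / (den s)%:R & (den s)%:R <= reach s].

Definition in_stage (R : realType) (n : nat) (s : stage R n) (xi : 'rV[R]_n.+1) :
    Prop := forall i, `|xi ord0 i - centre s ord0 i| <= halfwidth s.

(** The contribution of one stage, with error [e], to the upper limit being at
    most [c], to its being at least [c], and to the Liouville property. *)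
Definition window_ok (R : realType) (n : nat) (c e : R) (k : nat) (T T' : R)
    (xi : 'rV[R]_n.+1) : Prop :=
  [/\ forall Q, T <= Q <= T' -> Q ^+ n.+1 * psi_star xi Q <= c + e,
      exists2 Q, k%:R < Q & c - 2 * e <= Q ^+ n.+1 * psi_star xi Q &
      exists2 Q, k%:R < Q & Q ^+ k * psi_star xi Q <= e].

(** The value [A * B ^ N * (xi_0 - p/A)] will be prescribed between [l] and [h].
    The condition [h < 1] is what leaves room, also when [c = 1], between the
    form of height [A] and the forms not vanishing at the rational point. *)
Lemma target_interval (R : realType) (c e : R) :
  0 <= c <= 1 -> 0 < e -> 2 * e <= 1 ->
  exists l h, [/\ 0 <= l < h, h < 1, h <= c + e & c - 2 * e <= (1 - e) * l].
Proof.
move=> /andP[c0 c1] e0 e1; pose l := c * (1 - e).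
have ce : c * e <= e by rewrite -[leRHS]mul1r ler_wpM2r// ltW.
have ce0 : 0 <= c * e by rewrite mulr_ge0// ltW.
have cee : 0 <= c * e * e by rewrite mulr_ge0// ltW.
have lE : l = c - c * e by rewrite /l; ring.
have lE' : (1 - e) * l = c - 2 * (c * e) + c * e * e by rewrite /l; ring.
have l0 : 0 <= l by rewrite mulr_ge0//; lra.
have l1 : l <= 1 - e by rewrite -[leRHS]mul1r ler_wpM2r//; lra.
exists l, (l + e / 2); rewrite lE'.
by split; [apply/andP; split|..]; clearbody l; lra.
Qed.

Lemma large_prime (R : realType) (A k : nat) (rho l h : R) :
  0 < rho -> h < 1 ->
  exists B, [/\ prime B, (A < B)%N, 2 * (k%:R + 1) < B%:R :> R,
    B%:R^-1 <= rho / 2 & l * A%:R < (1 - h) * B%:R].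
Proof.
move=> rho0 h1; pose X := `|l| * A%:R / (1 - h).
have h10 : 0 < 1 - h by rewrite subr_gt0.
have X0 : 0 <= X by rewrite divr_ge0// ?mulr_ge0// ltW.
have Y0 : 0 < 2 / rho by rewrite divr_gt0.
have kR := ler0n R k.
have [B BZ Bp] := prime_above (A + Num.truncn (X + 2 / rho + 2 * (k%:R + 1))).
have ZB : X + 2 / rho + 2 * (k%:R + 1) < B%:R.
  apply: lt_le_trans (truncnS_gt _) _; rewrite ler_nat.
  by apply: leq_ltn_trans BZ; exact: leq_addl.
have B0 : 0 < B%:R :> R by rewrite ltr0n prime_gt0.
exists B; split=> //.
- by apply: leq_ltn_trans BZ; exact: leq_addr.
- by clearbody X; lra.
- rewrite -[leRHS]invrK lef_pV2 ?posrE// ?invr_gt0 ?divr_gt0// invf_div.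
  by clearbody X; lra.
- rewrite mulrC -[ltRHS]mulrC -ltr_pdivrMr//.
  apply: le_lt_trans (_ : X < _); last by clearbody X; lra.
  by rewrite ler_pM2r ?invr_gt0// mulrC ler_wpM2r// ler_norm.
Qed.

(** As the minimum is bounded below by [l / B ^ N] up to [B], values of Q just
    below [B] give nearly [l]; the loss is controlled by Bernoulli's
    inequality. *)
Lemma window_ok_of_bounds (R : realType) (n : nat) (xi : 'rV[R]_n.+1)
    (A B c e l h r T T' : R) (k : nat) :
  0 < e -> 2 * e <= 1 -> 0 <= c -> 0 <= l -> h <= c + e ->
  c - 2 * e <= (1 - e) * l ->
  1 <= A -> A <= T -> 2 * (k%:R + 1) < B ->
  T' ^+ n.+1 * (B * r) <= e -> B ^+ k * (B * r) <= e ->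
  (forall Q, A <= Q < B -> Q ^+ n.+1 * psi_star xi Q <= h) ->
  (forall Q, 1 <= Q < B -> l / B ^+ n.+1 <= psi_star xi Q) ->
  (forall Q, B <= Q -> psi_star xi Q <= B * r) ->
  window_ok c e k T T' xi.
Proof.
move=> e0 e1 c0 l0 hc cl A1 AT Bk T'r Br bA lB bB; have kR := ler0n R k.
have B0 : 0 < B by lra.
split=> [Q /andP[TQ QT']||].
- have Q1 : 1 <= Q by lra.
  have [QB|BQ] := ltP Q B.
    by apply: le_trans hc; apply: bA; rewrite (le_trans AT).
  apply: (@le_trans _ _ e); last by lra.
  apply: le_trans T'r.
  apply: ler_pM; rewrite ?exprn_ge0 ?psi_star_ge0 ?bB//; first by lra.
  by rewrite lerXn2r ?nnegrE//; lra.
(* The witness [B * (1 - a)], with [a = e / N], lies above [B / 2]. *)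
- have [a [a0 a1 ea]] : exists a, [/\ 0 < a, a <= e & e = n.+1%:R * a].
    exists (e / n.+1%:R); rewrite divr_gt0//; split=> //.
      by rewrite ler_pdivrMr// ler_peMr ?ler1n// ltW.
    by rewrite mulrC divfK// gt_eqF.
  have aB : a * B <= B / 2.
    by rewrite [leRHS]mulrC ler_wpM2r ?(ltW B0)//; lra.
  have aB0 : 0 < a * B by rewrite mulr_gt0.
  have Q1 : 1 <= B * (1 - a) < B by apply/andP; split; lra.
  exists (B * (1 - a)); first by lra.
  apply: (@le_trans _ _ ((B * (1 - a)) ^+ n.+1 * (l / B ^+ n.+1))).
    have -> : (B * (1 - a)) ^+ n.+1 * (l / B ^+ n.+1) = (1 - a) ^+ n.+1 * l.
      by rewrite mulrC exprMn mulrA divfK ?expf_neq0 ?gt_eqF// mulrC.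
    apply: le_trans cl _; rewrite ler_wpM2r// [in leLHS]ea.
    by apply: bernoulli_sub; apply/andP; split; lra.
  by rewrite ler_wpM2l ?exprn_ge0 ?lB// mulr_ge0//; lra.
- exists B; first by lra.
  by apply: le_trans Br; rewrite ler_wpM2l ?exprn_ge0 ?bB// ltW.
Qed.

(** The point is moved in the order: prime [B], coordinates of index at least
    1 to base-[B] fractions, first coordinate to a rational number in the target interval
    different from that of [y].  Only then is the new half-width chosen, so
    that it can be small compared with all the other quantities, including the
    new denominator. *)
Lemma next_stage (R : realType) (n : nat) (c e : R) (k : nat) (y : 'rV[R]_n.+1)
    (s : stage R n) :
  (0 < n)%N -> 0 <= c <= 1 -> 0 < e -> 2 * e <= 1 -> stage_ok s ->
  exists s', [/\ stage_ok s',
    forall i, `|centre s' ord0 i - centre s ord0 i| + halfwidth s' <= halfwidth s,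
    k.+1%:R <= reach s' &
    forall xi, in_stage s' xi ->
      xi <> y /\ window_ok c e k (reach s) (reach s') xi].
Proof.
case: s => x rho T A p n0 c01 e0 e1 [/= rho0 A0 pA x0 AT].
have [l [h [/andP[l0 lh] h1 hce cl]]] := target_interval c01 e0 e1.
have [B [Bp AB Bk Brho lAB]] := large_prime A k l rho0 h1.
have A1 : 1 <= A%:R :> R by rewrite ler1n.
have B1 : 1 <= B%:R :> R by rewrite ler1n prime_gt0.
have AR0 : 0 < A%:R :> R by apply: lt_le_trans A1.
have BR0 : 0 < B%:R :> R by apply: lt_le_trans B1.
have h0 : 0 < h by apply: le_lt_trans lh.
pose W : R := A%:R * B%:R ^+ n.+1.
have W0 : 0 < W by rewrite mulr_gt0// exprn_gt0.
have BW : B%:R <= W by rewrite -[leLHS]mul1r ler_pM ?ler_eXnr.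
have hW : h / W <= B%:R^-1.
  by rewrite -[leRHS]mul1r ler_pM ?invr_ge0 ?(ltW h0) ?(ltW W0) ?(ltW h1) ?lef_pV2 ?posrE.
have lW : 0 <= l / W by rewrite divr_ge0// ltW.
(* The room left at the rational point for the perturbation of size [r]. *)
pose gap := (1 - h) / (A%:R * B%:R ^+ n) - l / B%:R ^+ n.+1.
have gap0 : 0 < gap.
  have -> : gap = ((1 - h) * B%:R - l * A%:R) / W.
    by rewrite /gap /W exprS; field; rewrite !gt_eqF// exprn_gt0.
  by rewrite divr_gt0// subr_gt0.
have /boolp.choice[v vP] : forall j : 'I_n, exists u : int,
    ~~ (B%:Z %| u)%Z /\
    `|u%:~R / B%:R ^+ (n - j) - x ord0 (lift ord0 j)| <= B%:R^-1.
  move=> j; have nj : (0 < n - j)%N by rewrite subn_gt0.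
  by have [u] := prime_power_approx (x ord0 (lift ord0 j)) Bp nj; exists u.
have st : x ord0 ord0 + l / W < x ord0 ord0 + h / W.
  by rewrite ltrD2l ltr_pM2r// invr_gt0.
have [p' [A' [A'0 pA' sq qt qy]]] := rat_itv_avoid (y ord0 ord0) st.
set q : R := p'%:~R / A'%:R in sq qt qy.
pose x' : 'rV[R]_n.+1 := \row_i
  if i == ord0 then q else radix_point R p A B v ord0 i.
have x'0 : x' ord0 ord0 = q by rewrite mxE.
have x'S j : x' ord0 (lift ord0 j) = radix_point R p A B v ord0 (lift ord0 j).
  by rewrite mxE.
pose T' : R := A'%:R + k.+1%:R.
have T'0 : 0 < T' by rewrite addr_gt0// ltr0n.
have nR0 : 0 < n%:R :> R by rewrite ltr0n.
(* In order: nesting, avoiding [y], the two sides of the target interval, the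
   upper bound up to [T'], the Liouville bound at [B], and minimality of the
   form of height [A] before [B]. *)
have := @pos_lower_bound R [:: rho / 2; `|q - y ord0 ord0| / 2;
  q - (x ord0 ord0 + l / W); (x ord0 ord0 + h / W) - q;
  e / (T' ^+ n.+1 * B%:R); e / (B%:R ^+ k * B%:R); gap / (B%:R * n%:R)].
rewrite /= !divr_gt0 ?gap0 ?normr_gt0 ?subr_eq0 ?subr_gt0 ?sq ?qt ?mulr_gt0 ?exprn_gt0//.
move=> /(_ erefl)[r r0 /and5P[r_rho r_y r_l r_h /and4P[r_T r_k r_gap _]]].
exists (Stage x' r T' A' p'); split.
- by split=> //=; rewrite lerDl.
- move=> i /=; rewrite [leRHS]splitr; apply: lerD r_rho; apply: le_trans Brho.
  case: (unliftP ord0 i) => [j ->|->]; first by rewrite x'S radix_pointS (vP j).2.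
  by rewrite x'0 ger0_norm; move: sq qt hW lW; clear; lra.
- by rewrite /= lerDr.
move=> xi xin; have /= := xin ord0; rewrite x'0 ler_distl => /andP[xi1 xi2].
split.
  move=> xiy; have := xin ord0; rewrite /= x'0 xiy distrC.
  have : 0 < `|q - y ord0 ord0| by rewrite normr_gt0 subr_eq0.
  by move: r_y; clear; lra.
have xiW : l / W <= xi ord0 ord0 - p%:~R / A%:R <= h / W.
  by rewrite -x0; apply/andP; move: xi1 xi2 r_l r_h; clear; split; lra.
have xiS j : `|xi ord0 (lift ord0 j) -
    radix_point R p A B v ord0 (lift ord0 j)| <= r.
  by rewrite -x'S; exact: xin.
have gap' : l / B%:R ^+ n.+1 + B%:R * (n%:R * r) <=
    (1 - h) / (A%:R * B%:R ^+ n).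
  by rewrite addrC -lerBrDr -/gap mulrA mulrC -ler_pdivlMr// mulr_gt0//.
have [bA lB bB] :=
  stage_bounds n0 A0 pA Bp AB (fun j => (vP j).1) l0 (ltW h0) xiW xiS gap'.
have c0 : 0 <= c by case/andP: c01.
apply: (window_ok_of_bounds e0 e1 c0 l0 hce cl A1 AT Bk _ _ bA lB bB).
- by rewrite mulrA mulrC -ler_pdivlMr// mulr_gt0// exprn_gt0.
- by rewrite mulrA mulrC -ler_pdivlMr// mulr_gt0// exprn_gt0.
Qed.

(** * Existence of the vectors *)

Lemma nested_stages (R : realType) (n : nat) (S : nat -> stage R n) :
  (forall k, 0 <= halfwidth (S k)) ->
  (forall k i, `|centre (S k.+1) ord0 i - centre (S k) ord0 i| +
     halfwidth (S k.+1) <= halfwidth (S k)) ->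
  exists xi, forall k, in_stage (S k) xi.
Proof.
move=> r0 nest.
have lo_mono i j k : (j <= k)%N ->
    centre (S j) ord0 i - halfwidth (S j) <= centre (S k) ord0 i - halfwidth (S k).
  move=> /subnK <-; elim: (k - j)%N => [//|m IHm]; rewrite addSn.
  apply: le_trans IHm _; have := nest (m + j)%N i.
  by have := ler_norm (centre (S (m + j)%N) ord0 i -
    centre (S (m + j).+1) ord0 i); rewrite distrC; lra.
have hi_mono i j k : (j <= k)%N ->
    centre (S k) ord0 i + halfwidth (S k) <= centre (S j) ord0 i + halfwidth (S j).
  move=> /subnK <-; elim: (k - j)%N => [//|m IHm]; rewrite addSn.
  apply: le_trans IHm; have := nest (m + j)%N i.
  by have := ler_norm (centre (S (m + j).+1) ord0 i -
    centre (S (m + j)%N) ord0 i); lra.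
have lo_hi i j k :
    centre (S j) ord0 i - halfwidth (S j) <= centre (S k) ord0 i + halfwidth (S k).
  have := lo_mono i _ _ (leq_maxl j k); have := hi_mono i _ _ (leq_maxr j k).
  by have := r0 (maxn j k); lra.
pose E i := range (fun k => centre (S k) ord0 i - halfwidth (S k)).
(* Each coordinate is the least upper bound of the left endpoints. *)
exists (\row_i sup (E i)) => k i; rewrite mxE ler_distl; apply/andP; split.
  apply: ub_le_sup; last by exists k.
  by exists (centre (S k) ord0 i + halfwidth (S k)) => _ [j _ <-].
apply: ge_sup; first by exists (centre (S k) ord0 i - halfwidth (S k)), k.
by move=> _ [j _ <-].
Qed.

(** The ranges of consecutive stages overlap, so the bound [c + e k] given by
    each of them holds for all large Q; the lower bound and the Liouville bound
    each hold at one value of Q per stage, which is enough for an upper and a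
    lower limit. *)
Lemma exists_Liouville_avoiding (R : realType) (n : nat) (c : R)
    (y : nat -> 'rV[R]_n.+1) :
  (0 < n)%N -> 0 <= c <= 1 ->
  exists xi, [/\ forall k, xi <> y k, Theta_star xi = c%:E &
    Liouville_vector xi].
Proof.
move=> n0 c01; pose e k : R := k.+2%:R^-1.
have e0 k : 0 < e k by rewrite invr_gt0.
have e1 k : 2 * e k <= 1 by rewrite ler_pdivrMr// mul1r ler_nat.
have e_mono j k : (j <= k)%N -> e k <= e j.
  by move=> jk; rewrite lef_pV2 ?posrE// ler_nat.
pose good (s s' : stage R n) k :=
  [/\ forall i, `|centre s' ord0 i - centre s ord0 i| + halfwidth s' <= halfwidth s,
    k.+1%:R <= reach s' & forall xi, in_stage s' xi ->
      xi <> y k /\ window_ok c (e k) k (reach s) (reach s') xi].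
have /boolp.choice[F FP] : forall ks : nat * {s : stage R n | stage_ok s},
    exists s' : {s : stage R n | stage_ok s}, good (sval ks.2) (sval s') ks.1.
  move=> [k [s sok]].
  have [s' [s'ok ? ? ?]] := next_stage k (y k) n0 c01 (e0 k) (e1 k) sok.
  by exists (exist _ s' s'ok).
have init_ok : stage_ok (Stage (0 : 'rV[R]_n.+1) 1 1 1%N 0).
  by split=> //=; rewrite mxE mul0r.
pose G := fix G k := if k is j.+1 then F (j, G j) else exist _ _ init_ok.
pose S k := sval (G k).
have S_ok k : stage_ok (S k) by exact: svalP.
have S_good k : good (S k) (S k.+1) k by have := FP (k, G k).
have [xi xiS] : exists xi, forall k, in_stage (S k) xi.
  apply: nested_stages => k; first by have [/ltW] := S_ok k.
  by have [] := S_good k.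
have xi_good k : xi <> y k /\
    window_ok c (e k) k (reach (S k)) (reach (S k.+1)) xi.
  by have [_ _] := S_good k; apply.
have large (d M : R) (N : nat) : 0 < d ->
    exists k, [/\ (N < k)%N, M <= k%:R & 2 * e k <= d].
  move=> d0; pose z := Num.truncn (`|M| + 2 / d).
  have zP : `|M| + 2 / d < z.+1%:R by exact: truncnS_gt.
  have dP : 0 < 2 / d by rewrite divr_gt0.
  have zk : z.+1%:R <= (z + N).+1%:R :> R by rewrite ler_nat ltnS leq_addr.
  exists (z + N).+1; split; first by rewrite ltnS leq_addl.
    by have := ler_norm M; lra.
  rewrite ler_pdivrMr// mulrC -ler_pdivrMr// -natr1 -natr1.
  by have := normr_ge0 M; lra.
exists xi; split; first by move=> k; have [] := xi_good k.
  apply/eqP; rewrite eq_le; apply/andP; split.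
    apply: limf_esup_pinfty_le => d d0; have [K [_ _ eK]] := large d 0 0%N d0.
    have cover j Q : reach (S K) <= Q <= reach (S (K + j.+1)%N) ->
        Q ^+ n.+1 * psi_star xi Q <= c + e K.
      elim: j => [|j IHj].
        by rewrite addn1 => KQ; have [_ [w _ _]] := xi_good K; exact: w.
      move=> /andP[KQ QK]; have [QKj|KjQ] := leP Q (reach (S (K + j.+1)%N)).
        by apply: IHj; rewrite KQ.
      have [_ [w _ _]] := xi_good (K + j.+1)%N.
      apply: (@le_trans _ _ (c + e (K + j.+1)%N)).
        by apply: w; rewrite ltW//= -addnS.
      by rewrite lerD2l e_mono// leq_addr.
    exists (reach (S K)) => Q KQ.
    apply: (@le_trans _ _ (c + e K)); last by have := e0 K; lra.
    apply: (cover (Num.truncn Q)); rewrite ltW//=.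
    have [_ + _] := S_good (K + Num.truncn Q)%N; rewrite -addnS; apply: le_trans.
    by apply: ltW; apply: lt_le_trans (truncnS_gt Q) _; rewrite ler_nat addnS ltnS leq_addl.
  apply: le_limf_esup_pinfty => d M d0; have [k [_ Mk ek]] := large d M 0%N d0.
  have [_ [_ [Q kQ cQ] _]] := xi_good k.
  by exists Q; [exact: le_lt_trans kQ | lra].
move=> N; rewrite /limf_einf.
have -> : (\- (fun Q : R => (Q ^+ N * psi_star xi Q)%:E))%E =
    (fun Q : R => (- (Q ^+ N * psi_star xi Q))%:E) by [].
suff -> : limf_esup (fun Q : R => (- (Q ^+ N * psi_star xi Q))%:E)
    (pinfty_nbhs R) = 0%E by rewrite oppe0.
apply/eqP; rewrite eq_le; apply/andP; split.
  apply: limf_esup_pinfty_le => d d0; exists 1 => Q Q1.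
  have : 0 <= Q ^+ N * psi_star xi Q.
    by rewrite mulr_ge0 ?exprn_ge0 ?psi_star_ge0; lra.
  by lra.
apply: le_limf_esup_pinfty => d M d0; have [k [Nk Mk ek]] := large d M N d0.
have [_ [_ _ [Q kQ Qe]]] := xi_good k.
exists Q; first exact: le_lt_trans kQ.
have k1 : 1 <= k%:R :> R by rewrite ler1n; case: k Nk {Mk ek kQ Qe}.
have Q1 : 1 <= Q by lra.
have : Q ^+ N * psi_star xi Q <= Q ^+ k * psi_star xi Q.
  by rewrite ler_wpM2r ?psi_star_ge0// ler_weXn2l// ltnW.
by have := e0 k; lra.
Qed.

Lemma countable_enum (T : Type) (A : set T) (t : T) : countable A ->
  exists y : nat -> T, forall x, A x -> exists k, x = y k.
Proof.
move=> /countable_injP[f finj].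
have /boolp.choice[y yP] : forall k, exists u, forall x, A x -> f x = k -> x = u.
  move=> k; have [[u [Au fu]]|nu] := pselect (exists u, A u /\ f u = k).
    by exists u => x Ax fx; apply: finj; rewrite ?inE// fx.
  by exists t => x Ax fx; exfalso; apply: nu; exists x.
by exists y => x Ax; exists (f x); exact: yP.
Qed.

Unset Implicit Arguments.

Theorem theorem1p1 (R : realType) (n : nat) (hn : (2 <= n)%N) :
  @Dirichlet_spectrum R n = [set x : \bar R | (0 <= x <= 1)%E] /\
  forall c : R, 0 <= c <= 1 ->
    ~ countable [set xi : 'rV[R]_n | Theta_star xi = c%:E] /\
    ~ countable [set xi : 'rV[R]_n |
        Theta_star xi = c%:E /\ Liouville_vector xi].
Proof.
case: n hn => // n; rewrite ltnS => n0.
split=> [|c c01].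
  apply/seteqP; split=> [_ [xi _ <-]|x /andP[]] /=.
    by rewrite Theta_star_ge0 Theta_star_le1.
  case: x => [c| |] //; rewrite !lee_fin => c0 c1.
  have [|xi [_ xic _]] := @exists_Liouville_avoiding R n c (fun=> 0) n0.
    by rewrite c0.
  by exists xi.
have LU : ~ countable [set xi : 'rV[R]_n.+1 |
    Theta_star xi = c%:E /\ Liouville_vector xi].
  move=> /(countable_enum 0)[y yP].
  have [xi [xiy xic xiL]] := exists_Liouville_avoiding y n0 c01.
  by have [k] := yP xi (conj xic xiL); exact: xiy.
split=> // cT; apply: LU; apply: sub_countable cT.
by apply: subset_card_le => xi [].
Qed.
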